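(* Let $G_*$ be a strongly central series. The strongly central series $\mathcal A_*(G_* )$ acts canonically on $G_*$ in the category $\mathcal{SCF}$, and this action is universal: for every strongly central series $K_*$ and every action of $K_*$ on $G_*$ in $\mathcal{SCF}$, there is a unique morphism $K_*\to\mathcal A_*(G_* )$ in $\mathcal{SCF}$ such that the given action is obtained by restricting (pulling back) the canonical action along it.
   Context: A strongly central series (or strongly central filtration, $N$-series) $G_*$ is a group $G=G_1$ with a filtration by subgroups $G_1\supseteq G_2\supseteq\cdots$ such that $[G_i,G_j]\subseteq G_{i+j}$ for all $i,j\geq1$. $\mathcal{SCF}$ is the category of strongly central series, a morphism $G_*\to H_*$ being a group morphism $u:G_1\to H_1$ with $u(G_i)\subseteq H_i$ for all $i$. An action of $K_*$ on $G_*$ in $\mathcal{SCF}$ is a split extension with given splitting $G_*\hookrightarrow H_*\twoheadrightarrow K_*$ in $\mathcal{SCF}$, up to isomorphism of split extensions inducing the identity on $G_*$ and $K_*$: that is, a split extension of groups $G_1\hookrightarrow H_1\twoheadrightarrow K_1$ whose maps and chosen splitting preserve the filtrations, with $G_i$ the preimage of $H_i$ and $H_i\to K_i$ surjective for all $i$. The restriction of an action along a morphism $K'_*\to K_*$ is given by the pullback of the split extension. $\mathrm{Aut}(G_* )$ is the group of automorphisms of $G_*$ in $\mathcal{SCF}$, and for $j\ge 1$, $\mathcal A_j(G_* )=\{\sigma\in\mathrm{Aut}(G_* ): \forall i\geq1,\ \forall g\in G_i,\ \sigma(g)g^{-1}\in G_{i+j}\}$, i.e. the subgroup of automorphisms acting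 trivially on every quotient $G_i/G_{i+j}$; $\mathcal A_*(G_* )$ is a strongly central series on $\mathcal A_1(G_* )$. The canonical action is the one underlying the natural action of $\mathcal A_1(G_* )\subseteq\mathrm{Aut}(G_* )$ on $G_1$, with $H_i=G_i\rtimes\mathcal A_i(G_* )$. *)

(* Defs.v *)
From HB Require Import structures.
From mathcomp Require Import all_boot.
From mathcomp Require Import boolp classical_sets.

Set Implicit Arguments.
Unset Strict Implicit.
Unset Printing Implicit Defensive.

Local Open Scope classical_set_scope.
Local Open Scope group_scope.

Definition subgroup (G : groupType) (A : set G) : Prop :=
  [/\ A 1, forall x y, A x -> A y -> A (x * y) & forall x, A x -> A x^-1].

(* [~ a, b] is a^-1 * b^-1 * a * b; for subgroups A and B the result does not
   depend on this choice of commutator convention. *)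
Definition comm_subgroup (G : groupType) (A B : set G) : set G :=
  smallest (@subgroup G) [set [~ a, b] | a in A & b in B].

(* Filtrations are indexed from 1: the value at index 0 is never used. *)
HB.mixin Record hasFiltration (G : Type) := { fil : nat -> set G }.

#[short(type="filteredGroupType")]
HB.structure Definition FilteredGroup := { G of hasFiltration G & Group G }.

Arguments fil : clear implicits.

Definition strongly_central (G : filteredGroupType) : Prop :=
  [/\ forall i, (0 < i)%N -> subgroup (fil G i),
      fil G 1%N = setT,
      forall i, (0 < i)%N -> fil G i.+1 `<=` fil G i &
      forall i j, (0 < i)%N -> (0 < j)%N ->
        comm_subgroup (fil G i) (fil G j) `<=` fil G (i + j)%N].

HB.mixin Record isStronglyCentral G of FilteredGroup G := {
  scsP : strongly_central G
}.

#[short(type="scsType")]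
HB.structure Definition SCS := { G of isStronglyCentral G & FilteredGroup G }.

(* Between strongly central series, these are the morphisms of the category
   SCF; they are set up for all filtered groups so as to apply to the middle
   term of a split extension before it is known to be strongly central. *)
HB.mixin Record isFiltered (G H : filteredGroupType) (u : G -> H) := {
  filteredP : forall i, (0 < i)%N -> u @` fil G i `<=` fil H i
}.

HB.structure Definition SCFMorphism (G H : filteredGroupType) :=
  { u of isFiltered G H u & @UMagmaMorphism G H u }.

Notation "{ 'scf' G -> H }" := (SCFMorphism.type G%type H%type)
  (at level 0, G at level 98, H at level 99) : type_scope.

Section FiltrationTheory.
Variable G : scsType.
Implicit Types x y : G.

Lemma fil1 i : (0 < i)%N -> fil G i 1.
Proof. by move=> i0; case: (@scsP G) => /(_ i i0)[]. Qed.

Lemma filM i x y : (0 < i)%N -> fil G i x -> fil G i y -> fil G i (x * y).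
Proof. by move=> i0; case: (@scsP G) => /(_ i i0)[_ h _ _ _ _]; exact: h. Qed.

Lemma filV i x : (0 < i)%N -> fil G i x -> fil G i x^-1.
Proof. by move=> i0; case: (@scsP G) => /(_ i i0)[_ _ h _ _ _]; exact: h. Qed.

Lemma filT x : fil G 1 x.
Proof. by case: (@scsP G) => _ -> _ _. Qed.

Lemma fil_addr i k x : (0 < i)%N -> fil G (i + k) x -> fil G i x.
Proof.
move=> i0; elim: k => [|k IH]; first by rewrite addn0.
rewrite addnS => xP; apply: IH.
by case: (@scsP G) => _ _ h _; apply: h xP; rewrite addn_gt0 i0.
Qed.

Lemma filR i j x y : (0 < i)%N -> (0 < j)%N ->
  fil G i x -> fil G j y -> fil G (i + j) [~ x, y].
Proof.
move=> i0 j0 xi yj; case: (@scsP G) => _ _ _ /(_ i j i0 j0); apply.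
by apply: sub_gen_smallest; exists x => //; exists y.
Qed.

Lemma filJ i x y : (0 < i)%N -> fil G i x -> fil G i (x ^ y).
Proof.
move=> i0 xi; have -> : x ^ y = x * [~ x, y] by rewrite /commg mulVKg.
apply: filM => //; apply: (@fil_addr _ 1) => //; apply: filR => //.
exact: filT.
Qed.

End FiltrationTheory.

Lemma scfP (G H : filteredGroupType) (u : {scf G -> H}) i x :
  (0 < i)%N -> fil G i x -> fil H i (u x).
Proof. by move=> i0 xi; apply: (@filteredP G H u i i0); exists x. Qed.

Lemma scf_eqP (G H : filteredGroupType) (u v : {scf G -> H}) :
  u =1 v -> u = v.
Proof.
case: u v => [u [[a] [b] [c]]] [v [[a'] [b'] [c']]] /= /funext uv.
case: v / uv a' b' c' => a' b' c'.
by rewrite (Prop_irrelevance a a') (Prop_irrelevance b b')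
  (Prop_irrelevance c c').
Qed.

Lemma idfun_filtered (G : filteredGroupType) i :
  (0 < i)%N -> @idfun G @` fil G i `<=` fil G i.
Proof. by move=> _ _ [x xi <-]. Qed.
HB.instance Definition _ (G : filteredGroupType) :=
  isFiltered.Build G G idfun (@idfun_filtered G).

Lemma comp_filtered (G H K : filteredGroupType)
    (v : {scf H -> K}) (u : {scf G -> H}) i :
  (0 < i)%N -> (v \o u) @` fil G i `<=` fil K i.
Proof. by move=> i0 _ [x xi <-] /=; apply: scfP => //; exact: scfP. Qed.
HB.instance Definition _ (G H K : filteredGroupType)
    (v : {scf H -> K}) (u : {scf G -> H}) :=
  isFiltered.Build G K (v \o u) (@comp_filtered G H K v u).

(* An automorphism in the category: a filtered morphism together with its
   two-sided inverse, which must be filtered as well. *)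
Record scfAut (G : filteredGroupType) := ScfAut {
  autf :> {scf G -> G};
  autV : {scf G -> G};
  autK : cancel autf autV;
  autVK : cancel autV autf
}.

Lemma scfAut_eqP (G : filteredGroupType) (s t : scfAut G) : s =1 t -> s = t.
Proof.
case: s t => [s s' sK s'K] [t t' tK t'K] /= st.
have st' : s' =1 t' by move=> x; rewrite -{1}(t'K x) -st sK.
move/scf_eqP: st => st; move/scf_eqP: st' => st'; subst t t'.
by rewrite (Prop_irrelevance sK tK) (Prop_irrelevance s'K t'K).
Qed.

HB.instance Definition _ (G : filteredGroupType) := gen_eqMixin (scfAut G).
HB.instance Definition _ (G : filteredGroupType) := gen_choiceMixin (scfAut G).

Section AutGroup.
Variable G : filteredGroupType.
Implicit Types s t : scfAut G.

Definition aut1 : scfAut G :=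
  @ScfAut G idfun idfun (fun _ => erefl) (fun _ => erefl).
Definition autM s t : scfAut G :=
  @ScfAut G (s \o t) (autV t \o autV s)
    (can_comp (@autK G s) (@autK G t)) (can_comp (@autVK G t) (@autVK G s)).
Definition autI s : scfAut G :=
  @ScfAut G (autV s) s (@autVK G s) (@autK G s).

Lemma autMA : associative autM.
Proof. by move=> s t r; apply: scfAut_eqP. Qed.
Lemma aut1M : left_id aut1 autM.
Proof. by move=> s; apply: scfAut_eqP. Qed.
Lemma autM1 : right_id aut1 autM.
Proof. by move=> s; apply: scfAut_eqP. Qed.
Lemma autVM : left_inverse aut1 autI autM.
Proof. by move=> s; apply: scfAut_eqP => x /=; rewrite autK. Qed.
Lemma autMV : right_inverse aut1 autI autM.
Proof. by move=> s; apply: scfAut_eqP => x /=; rewrite autVK. Qed.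

HB.instance Definition _ :=
  isGroup.Build (scfAut G) autMA aut1M autM1 autVM autMV.

Lemma autME s t x : (s * t) x = s (t x). Proof. by []. Qed.
Lemma aut1E x : (1 : scfAut G) x = x. Proof. by []. Qed.
Lemma scfAutK s : cancel s (s^-1). Proof. exact: autK. Qed.
Lemma scfAutVK s : cancel (s^-1) s. Proof. exact: autVK. Qed.

End AutGroup.

(* The subgroup A_j(G_* ) of Aut(G_* ). *)
Definition andreadakis_aut (G : filteredGroupType) (j : nat) : set (scfAut G) :=
  [set s | forall i, (0 < i)%N ->
           forall g, fil G i g -> fil G (i + j) (s g * g^-1)].

Section AndreadakisAut.
Variable G : scsType.
Implicit Types s t : scfAut G.

Lemma andreadakis_aut_subgroup j : subgroup (@andreadakis_aut G j).
Proof.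
split.
- by move=> i i0 g _; rewrite aut1E mulgV; apply: fil1; rewrite addn_gt0 i0.
- move=> s t sj tj i i0 g gi; rewrite autME.
  rewrite -(mulgVK (t g) (s _)) -mulgA; apply: filM.
  + by rewrite addn_gt0 i0.
  + by apply: sj => //; apply: scfP.
  + exact: tj.
- move=> s sj i i0 g gi.
  have := sj i i0 (s^-1 g) (scfP _ i0 gi).
  rewrite scfAutVK => /filV; rewrite invgM invgK; apply.
  by rewrite addn_gt0 i0.
Qed.

Lemma andreadakis_aut_closed :
  group_closed (fun s => s \in @andreadakis_aut G 1).
Proof.
case: (andreadakis_aut_subgroup 1) => h1 hM hV.
split=> [|s t]; first exact/mem_set.
by move=> /set_mem hs /set_mem ht; apply/mem_set/hM => //; apply: hV.
Qed.

End AndreadakisAut.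

(* A_1(G_* ), which carries the strongly central series A_*(G_* ). *)
Definition andreadakis (G : scsType) : Type := set_type (@andreadakis_aut G 1).

Section Andreadakis.
Variable G : scsType.

HB.instance Definition _ := SubChoice.on (andreadakis G).
HB.instance Definition _ := SubChoice_isSubGroup.Build (scfAut G)
  (fun s => s \in @andreadakis_aut G 1) (andreadakis G)
  (@andreadakis_aut_closed G).

HB.instance Definition _ := hasFiltration.Build (andreadakis G)
  (fun j => [set s : andreadakis G | @andreadakis_aut G j (val s)]).

Implicit Types s t : scfAut G.

Lemma andreadakis_aut_comm_apply s t i j k g :
  (0 < i)%N -> (0 < j)%N -> (0 < k)%N ->
  andreadakis_aut i s -> andreadakis_aut j t -> fil G k g ->
  fil G (k + (i + j)) (s (t g) * (t (s g))^-1).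
Proof.
move=> i0 j0 k0 si tj gk.
have ki0 : (0 < k + i)%N by rewrite addn_gt0 k0.
have kj0 : (0 < k + j)%N by rewrite addn_gt0 k0.
have kij0 : (0 < k + (i + j))%N by rewrite addn_gt0 k0.
set a := s g * g^-1; set b := t g * g^-1.
have ak : fil G (k + i) a by apply: si.
have bk : fil G (k + j) b by apply: tj.
have xk : fil G (k + (i + j)) (s b * b^-1).
  by rewrite (addnC i) addnA; apply: si.
have yk : fil G (k + (i + j)) (t a * a^-1) by rewrite addnA; apply: tj.
have -> : s (t g) * (t (s g))^-1 =
    (s b * b^-1) * [~ b^-1, a^-1] * (t a * a^-1)^-1.
  have sE : s g = a * g by rewrite /a mulgVK.
  have tE : t g = b * g by rewrite /b mulgVK.
  clearbody a b; rewrite tE gmulfM /= sE gmulfM /= tE.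
  by rewrite /commg /conjg !invgM !invgK !mulgA ?mulgVK ?mulgK.
apply: filM => //; last exact: filV.
apply: filM => //; apply: (@fil_addr _ _ k) => //.
have -> : (k + (i + j) + k = (k + j) + (k + i))%N.
  by rewrite -!addnA (addnC i) -addnA.
by apply: filR => //; apply: filV.
Qed.

Lemma andreadakis_strongly_central : strongly_central (andreadakis G).
Proof.
have sub i : subgroup (fil (andreadakis G) i).
  case: (@andreadakis_aut_subgroup G i) => h1 hM hV.
  by split=> [|s t|s]; [exact: h1 | exact: hM | exact: hV].
split=> [i _ //||i i0 s si k k0 g gk|i j i0 j0].
- by apply/seteqP; split=> // s _; apply: set_mem (valP s).
- apply: (@fil_addr _ _ 1); first by rewrite addn_gt0 k0.
  by rewrite -addnA addn1; apply: si.
- apply: smallest_sub => // _ [s si [t tj <-]] k k0 g gk.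
  have sVi : andreadakis_aut i (val s)^-1.
    by case: (@andreadakis_aut_subgroup G i) => _ _; apply.
  have tVj : andreadakis_aut j (val t)^-1.
    by case: (@andreadakis_aut_subgroup G j) => _ _; apply.
  have := andreadakis_aut_comm_apply i0 j0 k0 sVi tVj
            (scfP (val s * val t) k0 gk).
  by rewrite /= !scfAutK.
Qed.

HB.instance Definition _ :=
  isStronglyCentral.Build (andreadakis G) andreadakis_strongly_central.

End Andreadakis.

(* A split extension of the underlying groups, whose middle term carries a
   filtration; compatibility with the filtrations is the content of
   [is_action] below. *)
Record splitExt (G K : filteredGroupType) := SplitExt {
  ext_mid :> filteredGroupType;
  ext_inj : UMagmaMorphism.type G ext_mid;
  ext_proj : UMagmaMorphism.type ext_mid K;
  ext_sec : UMagmaMorphism.type K ext_mid;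
  ext_inj_injective : injective ext_inj;
  ext_exact : range ext_inj = [set h | ext_proj h = 1];
  ext_secK : cancel ext_sec ext_proj
}.

Definition is_action (G K : scsType) (E : splitExt G K) : Prop :=
  [/\ strongly_central E,
      forall i, (0 < i)%N -> fil G i = ext_inj E @^-1` fil E i,
      forall i, (0 < i)%N -> ext_proj E @` fil E i = fil K i &
      forall i, (0 < i)%N -> ext_sec E @` fil K i `<=` fil E i].

(* Isomorphisms of split extensions in the category: isomorphisms of filtered
   groups inducing the identity on both ends and respecting the splittings. *)
Definition splitExt_iso (G K : filteredGroupType) (E F : splitExt G K) : Prop :=
  exists (phi : {scf E -> F}) (psi : {scf F -> E}),
    [/\ cancel phi psi, cancel psi phi,
        forall g, phi (ext_inj E g) = ext_inj F g,
        forall h, ext_proj F (phi h) = ext_proj E h &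
        forall k, phi (ext_sec E k) = ext_sec F k].

(* The restriction of an action: the subgroup of pairs of E * L agreeing over
   K, filtered as the limit computed in the category. *)
Section Pullback.
Variables (G K L : filteredGroupType) (u : {scf L -> K}) (E : splitExt G K).

Definition pullback_set : set (E * L)%type :=
  [set x | ext_proj E x.1 = u x.2].

Lemma pullback_closed : group_closed (fun x => x \in pullback_set).
Proof.
split=> [|x y /set_mem hx /set_mem hy]; apply/mem_set; rewrite /pullback_set /=.
  by rewrite !gmulf1.
by rewrite !gmulfF hx hy.
Qed.

Definition pullback : Type := set_type pullback_set.

HB.instance Definition _ := SubChoice.on pullback.
HB.instance Definition _ := SubChoice_isSubGroup.Build (E * L)%type
  (fun x => x \in pullback_set) pullback pullback_closed.
HB.instance Definition _ := hasFiltration.Build pullback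
  (fun i => [set x : pullback | fil E i (val x).1 /\ fil L i (val x).2]).

Definition pullback_pair x (xP : pullback_set x) : pullback :=
  exist _ x (mem_set xP).

Lemma pullback_injP g : pullback_set (ext_inj E g, 1).
Proof.
rewrite /pullback_set /= gmulf1.
have : range (ext_inj E) (ext_inj E g) by exists g.
by rewrite ext_exact.
Qed.

Lemma pullback_secP l : pullback_set (ext_sec E (u l), l).
Proof. by rewrite /pullback_set /= ext_secK. Qed.

Definition pullback_inj g : pullback := pullback_pair (pullback_injP g).
Definition pullback_proj (x : pullback) : L := (val x).2.
Definition pullback_sec l : pullback := pullback_pair (pullback_secP l).

Lemma pullback_injM : monoid_morphism pullback_inj.
Proof.
split=> [|x y]; apply: val_inj; rewrite ?val1 ?valM /=; congr (_, _).
- exact: gmulf1.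
- exact: gmulfM.
- by rewrite mulg1.
Qed.
HB.instance Definition _ :=
  isUMagmaMorphism.Build G pullback pullback_inj pullback_injM.

Lemma pullback_projM : monoid_morphism pullback_proj.
Proof. by split=> [|x y]; rewrite /pullback_proj ?val1 ?valM. Qed.
HB.instance Definition _ :=
  isUMagmaMorphism.Build pullback L pullback_proj pullback_projM.

Lemma pullback_secM : monoid_morphism pullback_sec.
Proof.
split=> [|x y]; apply: val_inj; rewrite ?val1 ?valM /=; congr (_, _).
- by rewrite !gmulf1.
- by rewrite !gmulfM.
Qed.
HB.instance Definition _ :=
  isUMagmaMorphism.Build L pullback pullback_sec pullback_secM.

Lemma pullback_inj_injective : injective pullback_inj.
Proof. by move=> x y /(congr1 val)[/ext_inj_injective]. Qed.

Lemma pullback_exact :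
  range pullback_inj = [set x | pullback_proj x = 1].
Proof.
apply/seteqP; split=> [_ [g _ <-] //|x x1].
have xP : ext_proj E (val x).1 = u (val x).2 by apply: set_mem (valP x).
have : [set h | ext_proj E h = 1] (val x).1.
  by rewrite /= xP -/(pullback_proj x) x1 gmulf1.
rewrite -ext_exact => -[g _ gx]; exists g => //.
apply: val_inj => /=; rewrite gx -[X in (_, X)]x1 /pullback_proj.
by rewrite -surjective_pairing.
Qed.

Lemma pullback_secK : cancel pullback_sec pullback_proj.
Proof. by []. Qed.

Definition pullback_ext : splitExt G L :=
  @SplitExt G L pullback pullback_inj pullback_proj pullback_sec
    pullback_inj_injective pullback_exact pullback_secK.

End Pullback.

(* The semidirect product of G and A_1(G_* ), filtered by the G_i >< A_i. *)
Section Canonical.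
Variable G : scsType.

Record canonical_sdprod := Sdpair { sdl : G; sdr : andreadakis G }.

Implicit Types x y z : canonical_sdprod.

HB.instance Definition _ := gen_eqMixin canonical_sdprod.
HB.instance Definition _ := gen_choiceMixin canonical_sdprod.

Definition sdprod1 := Sdpair 1 1.
Definition sdprodM x y := Sdpair (sdl x * val (sdr x) (sdl y)) (sdr x * sdr y).
Definition sdprodV x := Sdpair (val (sdr x)^-1 (sdl x)^-1) (sdr x)^-1.

Lemma sdprodMA : associative sdprodM.
Proof.
by move=> x y z; rewrite /sdprodM /= gmulfM !mulgA.
Qed.
Lemma sdprod1M : left_id sdprod1 sdprodM.
Proof. by case=> g s; rewrite /sdprodM /= !mul1g. Qed.
Lemma sdprodM1 : right_id sdprod1 sdprodM.
Proof. by case=> g s; rewrite /sdprodM /= gmulf1 !mulg1. Qed.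
Lemma sdprodVM : left_inverse sdprod1 sdprodV sdprodM.
Proof. by move=> x; rewrite /sdprodM /= -gmulfM !mulVg gmulf1. Qed.
Lemma sdprodMV : right_inverse sdprod1 sdprodV sdprodM.
Proof.
by move=> x; rewrite /sdprodM /= ?autVK ?scfAutVK !mulgV.
Qed.

HB.instance Definition _ :=
  isGroup.Build canonical_sdprod sdprodMA sdprod1M sdprodM1 sdprodVM sdprodMV.
HB.instance Definition _ := hasFiltration.Build canonical_sdprod
  (fun i => [set x | fil G i (sdl x) /\ fil (andreadakis G) i (sdr x)]).

Definition canonical_inj g := Sdpair g 1.
Definition canonical_sec s := Sdpair 1 s.

Lemma canonical_injM : monoid_morphism canonical_inj.
Proof.
by split=> // x y; rewrite [RHS]/(sdprodM _ _) /sdprodM /= mulg1.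
Qed.
HB.instance Definition _ :=
  isUMagmaMorphism.Build G canonical_sdprod canonical_inj canonical_injM.

Lemma canonical_projM : monoid_morphism sdr.
Proof. by []. Qed.
HB.instance Definition _ :=
  isUMagmaMorphism.Build canonical_sdprod (andreadakis G) sdr canonical_projM.

Lemma canonical_secM : monoid_morphism canonical_sec.
Proof.
by split=> // x y; rewrite [RHS]/(sdprodM _ _) /sdprodM /= gmulf1 mulg1.
Qed.
HB.instance Definition _ :=
  isUMagmaMorphism.Build (andreadakis G) canonical_sdprod canonical_sec
    canonical_secM.

Lemma canonical_inj_injective : injective canonical_inj.
Proof. by move=> x y []. Qed.

Lemma canonical_exact : range canonical_inj = [set x | sdr x = 1].
Proof.
by apply/seteqP; split=> [_ [g _ <-] //|[g s] /= ->]; exists g.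
Qed.

Lemma canonical_secK : cancel canonical_sec sdr.
Proof. by []. Qed.

Definition canonical_ext : splitExt G (andreadakis G) :=
  @SplitExt G (andreadakis G) canonical_sdprod canonical_inj sdr canonical_sec
    canonical_inj_injective canonical_exact canonical_secK.

End Canonical.

(* Main.v *)
Require Import Defs.
From HB Require Import structures.
From mathcomp Require Import all_boot.
From mathcomp Require Import boolp classical_sets.

(** An action of [K_*] on [G_*] is determined by the conjugation action of
    [K_1], embedded in the middle term [H_1] by the splitting, on [G_1]. For [k]
    in [K_j] and [g] in [G_i], the element [k g k^-1 g^-1] is a commutator of
    elements of [H_j] and [H_i], so it lies in the intersection of [G_1] and
    [H_(i+j)], which is [G_(i+j)]: conjugation by [k] belongs to [A_j(G_* )].
    An isomorphism with the pullback of the canonical action along [u] exists if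
    and only if [u] is this conjugation morphism. *)

Set Implicit Arguments.
Unset Strict Implicit.
Unset Printing Implicit Defensive.

Local Open Scope classical_set_scope.
Local Open Scope group_scope.

(** * The canonical action on the semidirect product *)

Lemma sdprodME (G : scsType) (x y : canonical_sdprod G) :
  x * y = Sdpair (sdl x * val (sdr x) (sdl y)) (sdr x * sdr y).
Proof. by []. Qed.

Lemma sdprodVE (G : scsType) (x : canonical_sdprod G) :
  x^-1 = Sdpair (val (sdr x)^-1 (sdl x)^-1) (sdr x)^-1.
Proof. by []. Qed.

(** The automorphism component is a commutator in [andreadakis G]. The other component is, up to a
    filtered automorphism, a product of three factors, each in degree [i + j]. *)
Lemma sdprod_commg_fil (G : scsType) i j (x y : canonical_sdprod G) :
  (0 < i)%N -> (0 < j)%N ->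
  fil (canonical_sdprod G) i x -> fil (canonical_sdprod G) j y ->
  fil (canonical_sdprod G) (i + j) [~ x, y].
Proof.
move=> i0 j0 [gi si] [hj tj].
have ij0 : (0 < i + j)%N by rewrite addn_gt0 i0.
(* In this form the automorphism [(t * s)^-1] comes out of the first component as a whole. *)
have -> : [~ x, y] = (y * x)^-1 * (x * y).
  by rewrite invgM commgEl /conjg !mulgA.
case: x y gi si hj tj => [g s] [h t] /= gi si hj tj.
split; last first.
  rewrite sdprodME sdprodVE !sdprodME /=.
  have -> : (t * s)^-1 * (s * t) = [~ s, t].
    by rewrite invgM commgEl /conjg !mulgA.
  exact: filR.
have -> : sdl ((Sdpair h t * Sdpair g s)^-1 * (Sdpair g s * Sdpair h t)) =
    val (t * s)^-1 ((h * val t g)^-1 * (g * val s h)) by rewrite gmulfM.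
apply: scfP => //.
set a := val s h * h^-1; set b := val t g * g^-1.
have ai : fil G (i + j) a by rewrite addnC; apply: si.
have bi : fil G (i + j) b by apply: tj.
(* Writing [s h] as [a * h] and [t g] as [b * g] turns the element into conjugates of [b^-1] and [a]
   around a plain commutator in [G]. *)
have -> : (h * val t g)^-1 * (g * val s h) = b^-1 ^ g * [~ g, h] * a ^ h.
  have -> : val s h = a * h by rewrite /a mulgVK.
  have -> : val t g = b * g by rewrite /b mulgVK.
  by rewrite /commg /conjg !invgM !mulgA ?mulgK ?mulgVK.
apply: filM => //; last exact: filJ.
by apply: filM => //; [apply/filJ/filV|apply: filR].
Qed.

Lemma sdprod_strongly_central (G : scsType) :
  strongly_central (canonical_sdprod G).
Proof.
have sub i : (0 < i)%N -> subgroup (fil (canonical_sdprod G) i).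
  move=> i0; split=> [|x y [xl xr] [yl yr]|x [xl xr]].
  - by split; apply: fil1.
  - by split; apply: filM => //; apply: scfP.
  - by split; [apply: scfP => //; apply: filV|apply: filV].
split=> //.
- by apply/seteqP; split=> // x _; split; apply: filT.
- move=> i i0 x []; rewrite -addn1 => xl xr.
  by split; [exact: fil_addr xl|exact: fil_addr xr].
- move=> i j i0 j0; apply: smallest_sub.
    by apply: sub; rewrite addn_gt0 i0.
  by move=> _ [x xi [y yj <-]]; apply: sdprod_commg_fil.
Qed.

Lemma canonical_ext_is_action (G : scsType) : is_action (canonical_ext G).
Proof.
split=> [|i i0|i i0|i i0]; first exact: sdprod_strongly_central.
- apply/seteqP; split=> [g gi|g []//].
  by split=> //; apply: fil1.
- apply/seteqP; split=> [_ [x [_ xr] <-] //|s si].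
  by exists (Sdpair 1 s) => //; split=> //; apply: fil1.
- by move=> _ [s si <-]; split=> //; apply: fil1.
Qed.

(** * The conjugation morphism of an action *)

(** Choice makes the preimage a datum, so that it can be used to define functions into [G]. *)
Lemma ext_kerP (G K : filteredGroupType) (E : splitExt G K) (h : E) :
  ext_proj E h = 1 -> {g | ext_inj E g = h}.
Proof.
move=> h1; apply: cid.
have : [set h | ext_proj E h = 1] h by [].
by rewrite -ext_exact => -[g _ <-]; exists g.
Qed.

Lemma ext_proj_inj (G K : filteredGroupType) (E : splitExt G K) (g : G) :
  ext_proj E (ext_inj E g) = 1.
Proof.
have : range (ext_inj E) (ext_inj E g) by exists g.
by rewrite ext_exact.
Qed.

(** An alias of [H] that carries the hypothesis as a structure: the filtration lemmas then apply to
    the middle term of an action. *)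
Definition scs_of (H : filteredGroupType) (scH : strongly_central H) : Type :=
  H.
HB.instance Definition _ (H : filteredGroupType) (scH : strongly_central H) :=
  FilteredGroup.on (scs_of scH).
HB.instance Definition _ (H : filteredGroupType) (scH : strongly_central H) :=
  isStronglyCentral.Build (scs_of scH) scH.

Section ConjugationMorphism.
Variables (G K : scsType) (E : splitExt G K) (actE : is_action E).

Let scE : strongly_central E. Proof. by case: actE. Qed.

Let H : scsType := scs_of scE.

Lemma fil_ext_inj i g : (0 < i)%N -> fil E i (ext_inj E g) <-> fil G i g.
Proof. by case: actE => _ + _ _ i0 => /(_ i i0) ->. Qed.

Lemma fil_ext_proj i h : (0 < i)%N -> fil E i h -> fil K i (ext_proj E h).
Proof. by case: actE => _ _ + _ i0 hi => /(_ i i0) <-; exists h. Qed.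

Lemma fil_ext_sec i k : (0 < i)%N -> fil K i k -> fil E i (ext_sec E k).
Proof. by case: actE => _ _ _ + i0 ki => /(_ i i0); apply; exists k. Qed.

Lemma fil_extM i (x y : E) : (0 < i)%N ->
  fil E i x -> fil E i y -> fil E i (x * y).
Proof. exact: (@filM H). Qed.

Lemma fil_extV i (x : E) : (0 < i)%N -> fil E i x -> fil E i x^-1.
Proof. exact: (@filV H). Qed.

Lemma ext_conj_ker k g :
  ext_proj E (ext_inj E g ^ (ext_sec E k)^-1) = 1.
Proof. by rewrite /conjg !gmulfM ext_proj_inj mul1g -gmulfM mulVg gmulf1. Qed.

(** Since [x ^ y] is [y^-1 * x * y], conjugating by the inverse gives a left action of [K]. *)
Definition ext_act k g : G := sval (ext_kerP (ext_conj_ker k g)).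

Lemma ext_actE k g :
  ext_inj E (ext_act k g) = ext_inj E g ^ (ext_sec E k)^-1.
Proof. exact: svalP (ext_kerP (ext_conj_ker k g)). Qed.

Lemma ext_act_morphism k : monoid_morphism (ext_act k).
Proof.
split=> [|x y]; apply: (@ext_inj_injective _ _ E); rewrite ?gmulfM !ext_actE.
  by rewrite !gmulf1 conj1g.
by rewrite gmulfM conjMg.
Qed.
HB.instance Definition _ k :=
  isUMagmaMorphism.Build G G (ext_act k) (ext_act_morphism k).

Lemma ext_act_filtered k i :
  (0 < i)%N -> ext_act k @` fil G i `<=` fil G i.
Proof.
move=> i0 _ [g gi <-]; apply/fil_ext_inj => //; rewrite ext_actE.
by apply: (@filJ H) => //; apply/fil_ext_inj.
Qed.
HB.instance Definition _ k :=
  isFiltered.Build G G (ext_act k) (@ext_act_filtered k).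

Lemma ext_act1 g : ext_act 1 g = g.
Proof.
by apply: (@ext_inj_injective _ _ E); rewrite ext_actE gmulf1 invg1 conjg1.
Qed.

Lemma ext_actM k l g : ext_act (k * l) g = ext_act k (ext_act l g).
Proof.
apply: (@ext_inj_injective _ _ E).
by rewrite !ext_actE gmulfM invgM conjgM.
Qed.

Lemma ext_actK k : cancel (ext_act k) (ext_act k^-1).
Proof. by move=> g; rewrite -ext_actM mulVg ext_act1. Qed.

Lemma ext_actVK k : cancel (ext_act k^-1) (ext_act k).
Proof. by move=> g; rewrite -ext_actM mulgV ext_act1. Qed.

Definition ext_aut k : scfAut G :=
  @ScfAut G (ext_act k) (ext_act k^-1) (@ext_actK k) (@ext_actVK k).

Lemma ext_aut_andreadakis k j :
  (0 < j)%N -> fil K j k -> andreadakis_aut j (ext_aut k).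
Proof.
move=> j0 kj i i0 g gi; apply/fil_ext_inj; first by rewrite addn_gt0 i0.
rewrite gmulfM ext_actE gmulfV.
(* The inverses match the convention [[~ a, b] = a^-1 * b^-1 * a * b]. *)
have -> : ext_inj E g ^ (ext_sec E k)^-1 * (ext_inj E g)^-1 =
    [~ (ext_sec E k)^-1, (ext_inj E g)^-1].
  by rewrite /commg /conjg !invgK !mulgA.
rewrite addnC; apply: (@filR H) => //; apply: (@filV H) => //.
  exact: fil_ext_sec.
exact/fil_ext_inj.
Qed.

Definition ext_mor k : andreadakis G :=
  exist _ (ext_aut k) (mem_set (ext_aut_andreadakis (ltn0Sn 0) (filT k))).

Lemma ext_mor_morphism : monoid_morphism ext_mor.
Proof.
split=> [|k l]; apply: val_inj; rewrite ?val1 ?valM; apply: scfAut_eqP => g.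
  exact: ext_act1.
exact: ext_actM.
Qed.
HB.instance Definition _ :=
  isUMagmaMorphism.Build K (andreadakis G) ext_mor ext_mor_morphism.

Lemma ext_mor_filtered i :
  (0 < i)%N -> ext_mor @` fil K i `<=` fil (andreadakis G) i.
Proof. by move=> i0 _ [k ki <-]; apply: ext_aut_andreadakis. Qed.
HB.instance Definition _ :=
  isFiltered.Build K (andreadakis G) ext_mor ext_mor_filtered.

(** * The isomorphism with the pullback of the canonical action *)

Lemma ext_residue_ker h :
  ext_proj E (h * (ext_sec E (ext_proj E h))^-1) = 1.
Proof. by rewrite gmulfM gmulfV ext_secK mulgV. Qed.

(** The [G]-component of [h] when the middle term is read as a semidirect product of [G] and [K]. *)
Definition ext_residue h : G := sval (ext_kerP (ext_residue_ker h)).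

Lemma ext_residueE h :
  ext_inj E (ext_residue h) = h * (ext_sec E (ext_proj E h))^-1.
Proof. exact: svalP (ext_kerP (ext_residue_ker h)). Qed.

Let P := pullback_ext (ext_mor : {scf K -> andreadakis G}) (canonical_ext G).

Lemma to_pullbackP h : pullback_set (ext_mor : {scf K -> andreadakis G})
  (E := canonical_ext G)
  (Sdpair (ext_residue h) (ext_mor (ext_proj E h)), ext_proj E h).
Proof. by []. Qed.

Definition to_pullback h : P := pullback_pair (to_pullbackP h).

Definition of_pullback (x : P) : E :=
  ext_inj E (sdl (val x).1) * ext_sec E (val x).2.

Lemma of_pullback_morphism : monoid_morphism of_pullback.
Proof.
split=> [|x y]; rewrite /of_pullback ?val1 /=; first by rewrite !gmulf1 mulg1.
have xP : sdr (val x).1 = ext_mor (val x).2 by apply: set_mem (valP x).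
rewrite !gmulfM xP ext_actE /conjg invgK !mulgA.
by rewrite mulgVK.
Qed.
HB.instance Definition _ :=
  isUMagmaMorphism.Build P E of_pullback of_pullback_morphism.

Lemma to_pullbackK : cancel to_pullback of_pullback.
Proof. by move=> h; rewrite /of_pullback /= ext_residueE mulgVK. Qed.

Lemma of_pullbackK : cancel of_pullback to_pullback.
Proof.
move=> x.
have xP : sdr (val x).1 = ext_mor (val x).2 by apply: set_mem (valP x).
have px : ext_proj E (of_pullback x) = (val x).2.
  by rewrite gmulfM ext_proj_inj mul1g ext_secK.
apply: val_inj; rewrite /= px -xP.
have -> : ext_residue (of_pullback x) = sdl (val x).1.
  by apply: (@ext_inj_injective _ _ E); rewrite ext_residueE px mulgK.
by case: x {xP px} => -[[g s] k] /=.
Qed.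

(** Inherited from the inverse bijection [of_pullback], whose multiplicativity is a direct
    computation. *)
Lemma to_pullback_morphism : monoid_morphism to_pullback.
Proof.
have injF := can_inj of_pullbackK.
split=> [|x y]; apply: injF; rewrite to_pullbackK ?gmulf1 //.
by rewrite of_pullback_morphism.2 !to_pullbackK.
Qed.
HB.instance Definition _ :=
  isUMagmaMorphism.Build E P to_pullback to_pullback_morphism.

Lemma to_pullback_filtered i :
  (0 < i)%N -> to_pullback @` fil E i `<=` fil P i.
Proof.
move=> i0 _ [h hi <-]; have pi := fil_ext_proj i0 hi.
split=> //; split; last exact: scfP.
apply/fil_ext_inj => //; rewrite ext_residueE.
by apply: fil_extM => //; apply: fil_extV => //; apply: fil_ext_sec.
Qed.
HB.instance Definition _ :=
  isFiltered.Build E P to_pullback to_pullback_filtered.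

Lemma of_pullback_filtered i :
  (0 < i)%N -> of_pullback @` fil P i `<=` fil E i.
Proof.
move=> i0 _ [x [[gi _] ki] <-]; apply: fil_extM => //; last exact: fil_ext_sec.
exact/fil_ext_inj.
Qed.
HB.instance Definition _ :=
  isFiltered.Build P E of_pullback of_pullback_filtered.

Lemma ext_mor_iso : splitExt_iso E P.
Proof.
exists to_pullback, of_pullback; split=> //.
- exact: to_pullbackK.
- exact: of_pullbackK.
(* Compatibility with the injections, and below with the sections, is checked in [E] through
   [of_pullback], which avoids computing [ext_residue]. *)
- move=> g; rewrite -[RHS]of_pullbackK; congr to_pullback.
  by rewrite /of_pullback /= gmulf1 mulg1.
- move=> k; rewrite -[RHS]of_pullbackK; congr to_pullback.
  by rewrite /of_pullback /= gmulf1 mul1g.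
Qed.

End ConjugationMorphism.

(** * Uniqueness of the classifying morphism *)

(** In the pullback, conjugating the image of [g] by the section of [k] applies [u k] to [g]. The
    isomorphism respects injections and sections, so it carries this relation back to [E]. *)
Lemma pullback_iso_conj (G K : scsType) (E : splitExt G K)
    (u : {scf K -> andreadakis G}) :
  splitExt_iso E (pullback_ext u (canonical_ext G)) ->
  forall k g, ext_inj E (val (u k) g) = ext_inj E g ^ (ext_sec E k)^-1.
Proof.
move=> [phi [psi [phiK psiK phi_inj _ phi_sec]]] k g.
(* Without inverses the relation compares two products, and [phi] is injective. *)
suff commE :
    ext_inj E (val (u k) g) * ext_sec E k = ext_sec E k * ext_inj E g.
  by rewrite /conjg invgK mulgA -commE mulgK.
have phiM x y : phi (x * y) = phi x * phi y by exact: gmulfM.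
apply: (can_inj phiK); rewrite !phiM !phi_inj !phi_sec.
apply: val_inj; rewrite !valM /=.
congr (_, _); last by rewrite mul1g mulg1.
by rewrite /canonical_inj /canonical_sec !sdprodME /= !mulg1 !mul1g.
Qed.

Theorem proposition1p22 (G : scsType) :
  is_action (canonical_ext G) /\
  forall (K : scsType) (E : splitExt G K), is_action E ->
    exists! u : {scf K -> andreadakis G},
      splitExt_iso E (pullback_ext u (canonical_ext G)).
Proof.
split=> [|K E actE]; first exact: canonical_ext_is_action.
exists (ext_mor actE); split=> [|v v_iso]; first exact: ext_mor_iso.
(* Pushed into [E], both morphisms send [k] and [g] to the same conjugate. *)
apply: scf_eqP => k; apply: val_inj; apply: scfAut_eqP => g.
apply: (@ext_inj_injective _ _ E).
by rewrite (pullback_iso_conj v_iso) ext_actE.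
Qed.
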